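(* Let $d$ be an odd positive integer. Then every isotropic 2-attractor in $\mathbb{R}^d$ is a (nondegenerate) parallelepiped.
   Context: An integer $d\times d$ matrix $M$ is called expanding if all its (complex) eigenvalues have modulus strictly greater than $1$. Let $M$ be an integer expanding $d\times d$ matrix with $|\det M|=2$ and let $D=\{\boldsymbol d_0,\boldsymbol d_1\}\subset\mathbb{Z}^d$ with $\boldsymbol d_1-\boldsymbol d_0\notin M\mathbb{Z}^d$. The 2-attractor generated by $M$ and $D$ is the compact set $G(M,D)=\{\sum_{k=1}^{\infty}M^{-k}\boldsymbol a_k : \boldsymbol a_k\in D \text{ for all } k\}\subset\mathbb{R}^d$. A matrix is isotropic if it is diagonalizable over $\mathbb{C}$ and all its eigenvalues have the same modulus (equivalently, it is similar over $\mathbb{R}$ to an orthogonal matrix multiplied by a number). A 2-attractor is called isotropic if it is generated by an isotropic matrix $M$. A parallelepiped in $\mathbb{R}^d$ is the image of the cube $[0,1]^d$ under an invertible affine map. *)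

(* Defs.v *)
From HB Require Import structures.
From mathcomp Require Import all_boot all_order all_algebra.
From mathcomp Require Import all_classical all_reals all_analysis.
From mathcomp Require Import complex.

Set Implicit Arguments.
Unset Strict Implicit.
Unset Printing Implicit Defensive.

Import Order.TTheory GRing.Theory Num.Theory.
Import numFieldNormedType.Exports.

Local Open Scope classical_set_scope.
Local Open Scope ring_scope.

Section Defs.
Variables (R : realType) (d : nat).

Definition mxC (M : 'M[int]_d) : 'M[R[i]%C]_d := map_mx intr M.

(* The modulus of a complex number is its norm, a nonnegative real number seen
   in R[i]; [1 < z] in R[i] requires z to be real. *)
Definition expanding (M : 'M[int]_d) : Prop :=
  forall z : R[i]%C, eigenvalue (mxC M) z -> 1 < `|z|.

Definition isotropic (M : 'M[int]_d) : Prop :=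
  diagonalizable (mxC M) /\
  forall z w : R[i]%C,
    eigenvalue (mxC M) z -> eigenvalue (mxC M) w -> `|z| = `|w|.

Definition two_attractor_data (M : 'M[int]_d) (d0 d1 : 'cV[int]_d) : Prop :=
  [/\ expanding M, `|\det M| = 2 &
      ~ exists v : 'cV[int]_d, d1 - d0 = M *m v].

(* The digit sequence is indexed from 0, so [a k] carries the factor
   M ^ -(k + 1). Both [invmx] and the powers are taken over R. *)
Definition attractor (M : 'M[int]_d) (D : set 'cV[int]_d) : set 'cV[R]_d :=
  [set x | exists2 a : nat -> 'cV[int]_d, (forall k, D (a k)) &
    series (fun k => (invmx (map_mx intr M : 'M[R]_d)) ^+ k.+1 *m
                     map_mx intr (a k)) @ \oo --> x].

Definition isotropic_two_attractor (G : set 'cV[R]_d) : Prop :=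
  exists (M : 'M[int]_d) (d0 d1 : 'cV[int]_d),
    [/\ two_attractor_data M d0 d1, isotropic M &
        G = attractor M [set d0; d1]].

Definition unit_cube : set 'cV[R]_d :=
  [set x : 'cV[R]_d | forall i, 0 <= x i ord0 <= 1].

Definition parallelepiped (P : set 'cV[R]_d) : Prop :=
  exists2 A : 'M[R]_d, A \in unitmx &
    exists b : 'cV[R]_d, P = [set A *m x + b | x in unit_cube].

End Defs.

(* Main.v *)
(* Since d is odd, M has a real eigenvalue l, and isotropy together with
   |det M| = 2 gives l^d = c with c = 2 or c = -2.  By Eisenstein X^d - c is
   irreducible over Q, hence it is the characteristic polynomial, M^d = c, and
   M^-1 v, ..., M^-d v are linearly independent for v = d1 - d0 != 0.
   Grouping the exponents of sum_k e_k M^-(k+1) v by residue mod d turns it into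
   sum_i t_i M^-(i+1) v, where the t_i = sum_j e_(jd+i) c^-j vary independently
   over all numbers with digits 0 and 1 in base c; these fill an interval of
   length 2. *)
Require Import Defs.
From mathcomp Require Import all_boot all_order all_algebra.
From mathcomp Require Import all_classical all_reals all_analysis.
From mathcomp Require Import complex polyrcf ring lra zify.

Set Implicit Arguments.
Unset Strict Implicit.
Unset Printing Implicit Defensive.

Import Order.TTheory GRing.Theory Num.Theory.
Import numFieldNormedType.Exports.

Local Open Scope classical_set_scope.
Local Open Scope ring_scope.

(** * The characteristic polynomial of [M] *)

Lemma map_mx_ratr_intr (F : numFieldType) (m n : nat) (A : 'M[int]_(m, n)) :
  map_mx ratr (map_mx intr A) = map_mx intr A :> 'M[F]_(m, n).
Proof. by apply/matrixP => i j; rewrite !mxE ratr_int. Qed.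

(** Eisenstein's criterion at the prime 2 over the integers: the constant coefficient [-c] is even
    but not divisible by 4. *)
Lemma irreducible_XnsubC2 (n : nat) (c : int) : (0 < n)%N -> `|c| = 2 ->
  irreducible_poly ('X^n - c%:~R%:P : {poly rat}).
Proof.
move=> n_gt0 c2.
have -> : 'X^n - c%:~R%:P = map_poly intr ('X^n - c%:P) :> {poly rat}.
  by rewrite rmorphB /= map_polyXn map_polyC.
apply/irreducible_rat_int; apply: (@eisenstein_crit 2) => //.
- by rewrite size_XnsubC // eqSS -lt0n.
- by rewrite (monicP (monicXnsubC _ n_gt0)).
- by rewrite coefB coefXn coefC /= eq_sym gtn_eqF // sub0r; lia.
- move=> i; rewrite size_XnsubC //= => i_lt.
  rewrite coefB coefXn coefC (ltn_eqF i_lt) sub0r.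
  by case: eqP => _; lia.
Qed.

Lemma isotropic_real_root (R : realType) (d : nat) (M : 'M[int]_d) :
  odd d -> isotropic R M -> `|\det M| = 2 ->
  exists (l : R) (c : int), [/\ root (char_poly (map_mx intr M)) l,
    `|c| = 2 & l ^+ d = c%:~R].
Proof.
move=> d_odd [_ iso] det2.
have [|l lP] := @odd_poly_root _ (char_poly (map_mx intr M : 'M[R]_d)).
  by rewrite size_char_poly /= negbK.
set p := char_poly (mxC R M).
have lE : eigenvalue (mxC R M) (l%:C)%C.
  rewrite eigenvalue_root_char.
  have -> : mxC R M = map_mx (real_complex R) (map_mx intr M).
    by rewrite -map_mx_comp; apply: eq_map_mx => k /=; rewrite rmorph_int.
  by rewrite -map_char_poly fmorph_root.
have [rs rsE] := closed_field_poly_normal p.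
have pm : p \is monic by apply: char_poly_monic.
rewrite (monicP pm) scale1r in rsE.
have sz : size rs = d.
  by apply/eqP; rewrite -eqSS -(size_prod_XsubC rs id) -rsE size_char_poly.
have nE : `|(l%:C)%C| ^+ d = 2.
  (* The constant coefficient is both [(-1)^d det M] and the product of the [-z] over the roots [z];
     each factor has the modulus of [l]. *)
  have := char_poly_det (mxC R M); rewrite -/p -horner_coef0 rsE horner_prod.
  move/(congr1 Num.norm); rewrite normr_prod.
  rewrite normrM normrX normrN1 expr1n mul1r.
  rewrite (det_map_mx intr) -intr_norm det2.
  rewrite (eq_big_seq (fun=> `|(l%:C)%C|)) => [|z z_rs].
    by rewrite big_const_seq count_predT sz -Monoid.iteropE.
  have zE : eigenvalue (mxC R M) z.
    by rewrite eigenvalue_root_char -/p rsE root_prod_XsubC.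
  rewrite hornerXsubC sub0r normrN.
  exact: (iso _ _ zE lE).
have : `|l ^+ d| = 2.
  apply: (@complexI R); rewrite rmorph_nat -nE.
  by rewrite normc_def /= expr0n addr0 sqrtr_sqr normrX rmorphXn.
move=> ld2; case: (ger0P (l ^+ d)) => s.
  by exists l, 2; split=> //; rewrite -(ger0_norm s) ld2.
exists l, (-2); split=> //.
by rewrite rmorphN /= -[LHS]opprK -(ltr0_norm s) ld2.
Qed.

(** Both polynomials have the root [l] in [R], so their gcd over the rationals is not constant;
    irreducibility makes it [X^d - c] up to a unit, which thus divides a monic polynomial of the
    same degree. *)
Lemma char_poly_XnsubC (R : numFieldType) (d : nat) (M : 'M[int]_d)
    (c : int) (l : R) :
  (0 < d)%N -> `|c| = 2 -> l ^+ d = c%:~R ->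
  root (char_poly (map_mx intr M)) l ->
  char_poly (map_mx intr M) = 'X^d - c%:~R%:P :> {poly rat}.
Proof.
move=> d_gt0 c2 ld lroot.
set p := char_poly _.
have irr := irreducible_XnsubC2 d_gt0 c2.
have lp : root (map_poly ratr p) l.
  by rewrite map_char_poly map_mx_ratr_intr.
have lq : root (map_poly ratr ('X^d - c%:~R%:P)) l.
  rewrite rmorphB /= map_polyXn map_polyC /= ratr_int.
  by rewrite rootE !hornerE ld subrr.
apply/eqP; rewrite -eqp_monic ?char_poly_monic ?monicXnsubC //.
have szE : size ('X^d - c%:~R%:P : {poly rat}) == size p.
  by rewrite size_XnsubC // size_char_poly.
case: irr => _ irr.
rewrite eqp_sym -dvdp_size_eqp //.
have [/eqP g1|g1] := eqVneq (size (gcdp ('X^d - c%:~R%:P) p)) 1%N.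
  have := @coprimep_root _ _ (map_poly ratr p) _ _ lq.
  by rewrite coprimep_map -rootE lp => /(_ g1).
have /eqp_dvdl <- := irr _ g1 (dvdp_gcdl _ _).
exact: dvdp_gcdr.
Qed.

(** * Linear independence of the vectors [M^-k v] *)

Lemma expmx_char_poly_XnsubC (F : fieldType) (n : nat) (M : 'M[F]_n.+1)
    (c : F) :
  char_poly M = 'X^(n.+1) - c%:P -> M ^+ n.+1 = c%:M.
Proof.
move=> pE; have := Cayley_Hamilton M.
rewrite pE rmorphB rmorphXn /= horner_mx_X horner_mx_C => /eqP.
by rewrite subr_eq0 => /eqP.
Qed.

(** Irreducibility and the smaller degree make a nonzero [q] coprime to the characteristic
    polynomial; by Bezout and Cayley-Hamilton [q(M)] is then invertible, which forces [v = 0]. *)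
Lemma horner_mx_irreducible_free (F : fieldType) (n : nat) (M : 'M[F]_n.+1)
    (q : {poly F}) (v : 'cV[F]_n.+1) :
  irreducible_poly (char_poly M) -> (size q <= n.+1)%N -> v != 0 ->
  horner_mx M q *m v = 0 -> q = 0.
Proof.
move=> [_ irr] q_size v0 qv0; apply/eqP; apply: contraNT v0 => q0.
have [/eqP g1|g1] := eqVneq (size (gcdp (char_poly M) q)) 1%N; last first.
  have /eqp_dvdl := irr _ g1 (dvdp_gcdl _ _).
  move=> /(_ q); rewrite dvdp_gcdr => /esym/(dvdp_leq q0).
  by rewrite size_char_poly ltnNge q_size.
have /Bezout_eq1_coprimepP[[a b] /= ab1] : coprimep (char_poly M) q by [].
have := congr1 (fun r => horner_mx M r *m v) ab1.
rewrite rmorphD !rmorphM rmorph1 /= Cayley_Hamilton mulr0 add0r.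
by rewrite -mulmxE -mulmxA qv0 mulmx0 mul1mx => <-.
Qed.

(** A linear relation among the columns, multiplied by [M^(n+1)], becomes a polynomial in [M] of
    degree at most [n] that kills [v]. *)
Lemma inverse_orbit_unitmx (F : fieldType) (n : nat) (M : 'M[F]_n.+1)
    (v : 'cV[F]_n.+1) :
  irreducible_poly (char_poly M) -> M \in unitmx -> v != 0 ->
  \matrix_(i, j < n.+1) (invmx M ^+ j.+1 *m v) i ord0 \in unitmx.
Proof.
move=> irr M_unit v0; set B := \matrix_(_, _) _.
rewrite -unitmx_tr unitmxE unitfE; apply/negP => /det0P[t t0 tB].
(* Since [M^(n+1) M^-(j+1) = M^(n-j)], the coefficients appear in reverse order. *)
pose t' := \row_j t ord0 (rev_ord j).
suff t'0 : rVpoly t' = 0.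
  case/eqP: t0; apply/rowP => j; rewrite mxE.
  by have := congr1 (fun u => poly_rV u ord0 (rev_ord j)) t'0;
    rewrite rVpolyK linear0 !mxE rev_ordK.
apply: (horner_mx_irreducible_free irr _ v0); first exact: size_poly.
have BtE : \sum_(j < n.+1) t ord0 j *: (invmx M ^+ j.+1 *m v) = 0.
  apply/colP => i; rewrite summxE [RHS]mxE.
  transitivity ((t *m B^T) ord0 i); last by rewrite tB mxE.
  rewrite [RHS]mxE; apply: eq_bigr => j _.
  by rewrite [LHS]mxE [B^T j i]mxE [B i j]mxE.
have := congr1 (mulmx (M ^+ n.+1)) BtE; rewrite mulmx0 mulmx_sumr => <-.
rewrite [rVpoly t']poly_def linear_sum mulmx_suml (reindex_inj rev_ord_inj) /=.
apply: eq_bigr => j _.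
rewrite -![(n.+1 - j.+1)%N]/(val (rev_ord j)) valK mxE rev_ordK.
rewrite linearZ rmorphXn /= horner_mx_X -scalemxAl -scalemxAr mulmxA.
congr (_ *: (_ *m _)); rewrite -[invmx M]/(M^-1) exprVn mulmxE.
exact: exprB.
Qed.

(** * Sums over residue classes *)

(** Going from [n] to [n + 1], the bound on the right grows by one exactly when [d] divides
    [n + d - i], that is when [n] is congruent to [i]. *)
Lemma sum_residue_class (V : nmodType) (F : nat -> V) (d i n : nat) :
  (i < d)%N ->
  \sum_(0 <= k < n | (k %% d)%N == i) F k =
  \sum_(0 <= j < ((n + (d - i.+1)) %/ d)%N) F (j * d + i)%N.
Proof.
move=> i_lt; elim: n => [|n IH].
  by rewrite add0n divn_small ?big_geq //; lia.
rewrite big_mkcond big_nat_recr //= -big_mkcond /= IH addSn divnS; last by lia.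
have -> : (d %| (n + (d - i.+1)).+1)%N = ((n %% d)%N == i).
  have -> : ((n + (d - i.+1)).+1 = n %/ d * d + (n %% d + (d - i)))%N.
    by rewrite addnA -divn_eq; lia.
  rewrite dvdn_addr ?dvdn_mull //.
  have m_lt := ltn_pmod n (leq_ltn_trans (leq0n i) i_lt).
  (* [n %% d + (d - i)] lies strictly between 0 and [2 d], so it is a multiple of [d] only if it
     equals [d]. *)
  apply/idP/eqP => [/dvdnP[[|[|k]]]|->]; try nia.
  by rewrite subnKC ?dvdnn // ltnW.
have [nE|_] := eqVneq; last by rewrite addr0 add0n.
rewrite add1n big_nat_recr //=; congr (_ + F _).
suff -> : ((n + (d - i.+1)) %/ d = n %/ d)%N by rewrite -nE -divn_eq.
rewrite {1}(divn_eq n d) nE -addnA divnMDl ?(leq_ltn_trans _ i_lt) //.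
by rewrite [((i + _) %/ d)%N]divn_small ?addn0 //; lia.
Qed.

Lemma cvg_divnr (b d : nat) : (0 < d)%N ->
  (fun n => (n + b) %/ d)%N @ \oo --> \oo.
Proof.
move=> d0; apply/cvgnyPge => A; near=> n; rewrite leq_divRL //.
apply: leq_trans (leq_addr _ _); near: n; exact: nbhs_infty_ge.
Unshelve. all: by end_near. Qed.

(** * Expansions with digits 0 and 1 *)

Lemma is_cvg_digit_series (R : realType) (q : R) (e : nat -> bool) : `|q| < 1 ->
  cvgn (series (fun k => (e k)%:R * q ^+ k)).
Proof.
move=> q1; apply: normed_cvg.
apply: (@series_le_cvg _ _ (geometric 1 `|q|)) => [n|n|n|].
- exact: normr_ge0.
- by rewrite /= mul1r exprn_ge0.
- by rewrite /= normrM normrX ler_wpM2r ?exprn_ge0 // normr_nat; case: (e n).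
- by apply: is_cvg_geometric_series; rewrite normr_id.
Qed.

(** Horner's recursion: the first digit plus [q] times the sum for the shifted sequence. The shift
    is why the induction runs over all [e] at once. *)
Lemma digit_sum_bounds (R : realType) (q lo hi : R) :
  lo <= 0 <= hi ->
  (forall (b : bool) r, lo <= r <= hi -> lo <= b%:R + q * r <= hi) ->
  forall (e : nat -> bool) n, lo <= series (fun k => (e k)%:R * q ^+ k) n <= hi.
Proof.
move=> I0 IS e n; elim: n e => [|n IH] e; first by rewrite /series /= big_geq.
have := IS (e 0%N) _ (IH (fun k => e k.+1)).
rewrite [X in _ + _ * X]/series /= mulr_sumr.
under eq_bigr do rewrite mulrCA -exprS.
by rewrite /series /= big_nat_recl // expr0 mulr1.
Qed.

(* Greedy algorithm: the remainders r_(k+1) = (r_k - e_k) / q stay bounded. *)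
Lemma greedy_digits (R : realType) (q lo hi : R) :
  q != 0 -> `|q| < 1 ->
  (forall r, lo <= r <= hi -> exists b : bool, lo <= (r - b%:R) / q <= hi) ->
  forall y, lo <= y <= hi ->
  exists e : nat -> bool, series (fun k => (e k)%:R * q ^+ k) @ \oo --> y.
Proof.
move=> q0 q1 step y yI.
have /boolp.choice[f fP] : forall r, exists b : bool, lo <= r <= hi ->
    lo <= (r - b%:R) / q <= hi.
  move=> r; have [/step[b bP]|_] := boolP (lo <= r <= hi); first by exists b.
  by exists true.
pose r := fix r n := if n is m.+1 then (r m - (f (r m))%:R) / q else y.
have rI n : lo <= r n <= hi by elim: n => //= n IH; exact: fP.
exists (f \o r).
(* From [r_k = e_k + q r_(k+1)] the partial sums telescope; the error [q^n r_n] tends to 0 because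
   the remainders stay in the interval. *)
have sE : series (fun k => ((f \o r) k)%:R * q ^+ k) =
    (fun n => y - q ^+ n * r n).
  apply/funext => n; rewrite /series /=; elim: n => [|n IH].
    by rewrite big_geq // expr0 mul1r subrr.
  rewrite big_nat_recr //= IH exprSr; field.
  exact: q0.
rewrite sE -[X in _ --> X]subr0; apply: cvgB; first exact: cvg_cst.
pose K := `|lo| + `|hi|.
apply: (@squeeze_cvgr _ _ _ _ (fun n => - (K * `|q| ^+ n))
  (fun n => K * `|q| ^+ n)).
- near=> n; rewrite -ler_norml normrM normrX mulrC ler_wpM2r ?exprn_ge0 //.
  have /andP[? ?] := rI n; rewrite /K ler_norml.
  have := ler_norm hi; have := ler_norm (- lo); rewrite normrN.
  have := normr_ge0 hi; have := normr_ge0 lo; lra.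
- rewrite -oppr0; apply: cvgN.
  by apply: cvg_geometric; rewrite normr_id.
- by apply: cvg_geometric; rewrite normr_id.
Unshelve. all: by end_near. Qed.

(** The interval [I = [lo, lo + 2]] is the union of [I / c] and [1 + I / c], which have length 1 and
    share one endpoint; the greedy digit compares with that endpoint. *)
Lemma digit_interval (R : realType) (c : int) : `|c| = 2 -> exists lo : R,
  (forall (e : nat -> bool) n,
     lo <= series (fun k => (e k)%:R * (c%:~R)^-1 ^+ k) n <= lo + 2) /\
  (forall y, lo <= y <= lo + 2 -> exists e : nat -> bool,
     series (fun k => (e k)%:R * (c%:~R)^-1 ^+ k) @ \oo --> y).
Proof.
move=> c2; have [->|->] : c = 2 \/ c = -2 by lia.
- have -> : 2%:~R = 2 :> R by [].
  exists 0; split.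
    apply: digit_sum_bounds; first by lra.
    by move=> [] r /=; lra.
  apply: greedy_digits => [||r rI].
  + by rewrite invr_eq0 ?oppr_eq0 pnatr_eq0.
  + by rewrite ger0_norm; lra.
  + exists (1 <= r); have := rI; rewrite invrK.
    by case: (leP 1 r) => /=; lra.
- have -> : (-2)%:~R = - 2 :> R by rewrite rmorphN.
  (* -2/3 is the sum of the terms of odd index of sum_j (-2)^-j. *)
  exists (- (2 / 3)); split.
    apply: digit_sum_bounds; first by lra.
    by move=> [] r /=; lra.
  apply: greedy_digits => [||r rI].
  + by rewrite invr_eq0 ?oppr_eq0 pnatr_eq0.
  + by rewrite ler0_norm; lra.
  (* Here [I = [-2/3, 4/3]], with halves [-I/2 = [-2/3, 1/3]] and [1 - I/2 = [1/3, 4/3]]. *)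
  + exists (1 / 3 <= r); have := rI; rewrite invrK.
    by case: (leP (1 / 3) r) => /=; lra.
Qed.

(** * Vector series and the attractor *)

(** Since [N^(k+1) = q^(k %/ d) N^(k %% d + 1)], the partial sums are combinations of [d] fixed
    vectors, and only the scalar coefficients vary with [n]. *)
Lemma series_powers_root_scalar (R : realType) (d : nat) (N : 'M[R]_d) (q : R)
    (w : 'cV[R]_d) (x : nat -> R) (L : 'I_d -> R) :
  N ^+ d = q%:M ->
  (forall i : 'I_d, series (fun j => x (j * d + i)%N * q ^+ j) @ \oo --> L i) ->
  series (fun k => x k *: (N ^+ k.+1 *m w)) @ \oo -->
  \sum_i L i *: (N ^+ i.+1 *m w).
Proof.
move=> NE xL.
pose u n (i : 'I_d) :=
  \sum_(0 <= k < n | (k %% d)%N == i) x k * q ^+ (k %/ d)%N.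
have uL i : u n i @[n --> \oo] --> L i.
  have d0 : (0 < d)%N := leq_ltn_trans (leq0n i) (ltn_ord i).
  (* The coefficient is a partial sum for the [i]-th subsequence, with an index that tends to
     infinity with [n]. *)
  have -> : u^~ i = series (fun j => x (j * d + i)%N * q ^+ j) \o
                    (fun n => (n + (d - i.+1)) %/ d)%N.
    apply/funext => n; rewrite /u sum_residue_class //= /series /=.
    apply: eq_bigr => j _.
    by rewrite divnMDl // divn_small // addn0.
  by apply: cvg_comp (xL i); exact: cvg_divnr.
have -> : series (fun k => x k *: (N ^+ k.+1 *m w)) =
    (fun n => \sum_i u n i *: (N ^+ i.+1 *m w)).
  apply/funext => n; rewrite /series /u /=.
  under [RHS]eq_bigr do rewrite scaler_suml big_mkcond.
  rewrite exchange_big /=; apply: eq_bigr => k _.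
  (* The residue of [k] is an index in ['I_d] only for [d > 0]; for [d = 0] the vectors have no
     entries. *)
  case: d N w L NE xL u uL => [|d] N w L NE xL u uL.
    by rewrite big_ord0; apply/colP => -[].
  pose i0 := Ordinal (ltn_pmod k (ltn0Sn d)).
  rewrite -big_mkcond (big_pred1 i0) => [|i]; last by rewrite eq_sym.
  rewrite -scalerA; congr (_ *: _).
  rewrite {1}(divn_eq k d.+1) -addnS exprD mulnC exprM NE /=.
  rewrite -scalemx1 exprZn expr1n -mulmxE -scalemxAl -scalemxAl.
  by rewrite mul1mx.
apply: cvg_big => [|i _].
  exact: add_continuous.
by apply: cvgZr_tmp; exact: uL.
Qed.

Theorem theorem3 (R : realType) (d : nat) (d_odd : odd d)
    (G : set 'cV[R]_d) (hG : isotropic_two_attractor G) :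
  parallelepiped G.
Proof.
case: hG => M [d0 [d1 [[_ det2 d01] iso ->]]].
case: d d_odd G M d0 d1 det2 d01 iso => // n d_odd _ M d0 d1 det2 d01 iso.
have [l [c [lroot c2 ld]]] := isotropic_real_root d_odd iso det2.
have pE := char_poly_XnsubC (ltn0Sn n) c2 ld lroot.
pose MQ : 'M[rat]_n.+1 := map_mx intr M.
pose MR : 'M[R]_n.+1 := map_mx intr M.
have MQR : map_mx ratr MQ = MR by exact: map_mx_ratr_intr.
have MQ_unit : MQ \in unitmx.
  by rewrite unitmxE unitfE det_map_mx intr_eq0 -normr_eq0 det2.
pose v := d1 - d0.
pose vQ : 'cV[rat]_n.+1 := map_mx intr v.
have vQR : map_mx ratr vQ = map_mx intr v :> 'cV[R]_n.+1.
  exact: map_mx_ratr_intr.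
(* [v = 0] would put [d1 - d0] in the image of [M], as [M *m 0]. *)
have v0 : vQ != 0.
  apply: contra_notN d01 => /eqP vE; exists 0; rewrite mulmx0 -/v.
  apply/matrixP => i j; apply: (@intr_inj rat).
  by have /matrixP/(_ i j) := vE; rewrite [vQ i j]mxE => ->; rewrite !mxE.
set N := invmx MR.
pose B : 'M[R]_n.+1 := \matrix_(i, j) (N ^+ j.+1 *m map_mx intr v) i ord0.
have NQR : map_mx ratr (invmx MQ) = N by rewrite map_invmx MQR.
(* Irreducibility is known over the rationals, so invertibility is proved there and carried to
   [R]. *)
have B_unit : B \in unitmx.
  have -> : B = map_mx ratr
      (\matrix_(i, j < n.+1) (invmx MQ ^+ j.+1 *m vQ) i ord0).
    apply/matrixP => i j; rewrite [LHS]mxE [RHS]mxE [in RHS]mxE.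
    have -> : N ^+ j.+1 *m map_mx intr v =
        map_mx ratr (invmx MQ ^+ j.+1 *m vQ).
      by rewrite -vQR map_mxM rmorphXn /= NQR.
    by rewrite mxE.
  rewrite map_unitmx; apply: inverse_orbit_unitmx => //.
  by rewrite pE; exact: irreducible_XnsubC2.
have NE : N ^+ n.+1 = (c%:~R)^-1%:M.
  rewrite -[N]/(MR^-1) exprVn -MQR -rmorphXn (expmx_char_poly_XnsubC pE) /=.
  by rewrite map_scalar_mx /= ratr_int; exact: invmx_scalar.
have [lo [lo_bounds lo_digits]] := digit_interval R c2.
have q1 : `|(c%:~R)^-1 : R| < 1.
  by rewrite normfV -intr_norm c2 invf_lt1 ?ltr0n // ltr1n.
pose S (e : nat -> bool) : R^nat :=
  series (fun k => (e k)%:R * (c%:~R)^-1 ^+ k).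
pose T e : R := limn (S e).
(* [b0] is the point with constant digit [d0], treated as a series with all coefficients 1. *)
pose b0 := \sum_(i < n.+1) T xpredT *: (N ^+ i.+1 *m map_mx intr d0).
have BE (y : 'cV[R]_n.+1) :
    \sum_(i < n.+1) y i ord0 *: (N ^+ i.+1 *m map_mx intr v) = B *m y.
  apply/colP => i; rewrite summxE !mxE; apply: eq_bigr => j _.
  by rewrite mulrC [B i j]mxE !mxE.
(* Write [a k] as [d0] plus [e k] times [v]: the residue classes of [e] give the coordinates [y] in
   the columns of [B], and [d0] contributes the translation [b0]. *)
have attrE (a : nat -> 'cV[int]_n.+1) (e : nat -> bool) (y : 'cV[R]_n.+1) :
    (forall k, a k = if e k then d1 else d0) ->
    (forall i : 'I_n.+1, S (fun j => e (j * n.+1 + i)%N) @ \oo --> y i ord0) ->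
    series (fun k => N ^+ k.+1 *m map_mx intr (a k)) @ \oo --> B *m y + b0.
  move=> aE ey.
  have -> : series (fun k => N ^+ k.+1 *m map_mx intr (a k)) =
      series (fun k => (e k)%:R *: (N ^+ k.+1 *m map_mx intr v)) +
      series (fun k => (true : nat)%:R *: (N ^+ k.+1 *m map_mx intr d0)).
    apply/funext => m; rewrite fctE /series /= -big_split /=.
    apply: eq_bigr => k _; rewrite scale1r aE /v map_mxB mulmxBr.
    by case: (e k); rewrite ?scale1r ?scale0r ?subrK ?add0r.
  rewrite -BE; apply: cvgD.
    apply: (@series_powers_root_scalar _ _ _ _ _ (fun k => (e k)%:R)
      (fun i => y i ord0) NE) => i.
    exact: ey.
  apply: (@series_powers_root_scalar _ _ _ _ _ (fun=> (true : nat)%:R)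
    _ NE) => i.
  exact: (@is_cvg_digit_series _ _ xpredT).
(* The cube with edges [[lo, lo + 2]] is the unit cube scaled by 2 and shifted by [lo]; [B] and [b0]
   then map it onto the attractor. *)
exists (2 *: B); first by rewrite unitmxZ // unitfE pnatr_eq0.
exists (B *m const_mx lo + b0).
have cubeE x : (2 *: B) *m x + (B *m const_mx lo + b0) =
    B *m (2 *: x + const_mx lo) + b0.
  by rewrite mulmxDr addrA -scalemxAl -scalemxAr.
apply/seteqP; split => x.
  case=> a aD ax.
  pose e k := a k == d1.
  have aE k : a k = if e k then d1 else d0.
    by rewrite /e; case: eqP => // ad; case: (aD k).
  pose y : 'cV[R]_n.+1 := \col_i T (fun j => e (j * n.+1 + i)%N).
  have ey (i : 'I_n.+1) : S (fun j => e (j * n.+1 + i)%N) @ \oo --> y i ord0.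
    by rewrite mxE; exact: is_cvg_digit_series.
  have -> : x = B *m y + b0.
    by apply: cvg_unique ax (attrE _ _ _ aE ey); exact: norm_hausdorff.
  exists (2^-1 *: (y - const_mx lo)) => [i|].
    have : lo <= y i ord0 <= lo + 2.
      have eI := lo_bounds (fun j => e (j * n.+1 + i)%N).
      apply/andP; split;
        [apply: cvgr_to_ge (ey i) _|apply: cvgr_to_le (ey i) _];
        by near=> m; case/andP: (eI m).
    have -> : (2^-1 *: (y - const_mx lo)) i ord0 = 2^-1 * (y i ord0 - lo).
      by rewrite !mxE.
    by move: (y i ord0) => z; lra.
  by rewrite cubeE scalerA divff ?pnatr_eq0 // scale1r subrK.
case=> y y01 <-; rewrite cubeE.
have /boolp.choice[f fP] : forall i : 'I_n.+1, exists e : nat -> bool,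
    S e @ \oo --> (2 *: y + const_mx lo) i ord0.
  move=> i; apply: lo_digits; rewrite !mxE; have := y01 i; lra.
(* Interleaving: position [k] carries digit [k %/ n.+1] of the expansion chosen for coordinate
   [k %% n.+1]. *)
pose e k := f (inord (k %% n.+1)) (k %/ n.+1)%N.
exists (fun k => if e k then d1 else d0) => [k|].
  by case: (e k); [right|left].
apply: (attrE _ e) => // i.
suff -> : (fun j => e (j * n.+1 + i)%N) = f i by exact: fP.
apply/funext => j; rewrite /e modnMDl modn_small // inord_val.
by rewrite divnMDl // divn_small // addn0.
Unshelve. all: by end_near. Qed.
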